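(* Let $t>2$ be a natural number and $n=5t$, and let $D_t=2^{4t}+2^{3t}+2^{2t}+2^t-1$ be the Dobbertin exponent. Then $D_t$ never lies in the cyclotomic coset of $e(l,k)$ modulo $2^n-1$, for any natural number $l$ and any natural number $k$ with $\gcd(k,n)\le 2$.
   Context: For natural numbers $l,k$, $e(l,k)=\sum_{j=0}^{l-1}2^{jk}$. The cyclotomic coset of $d$ modulo $2^n-1$ is $\{2^a d \bmod (2^n-1): a\ge 0\}$. *)

(* Defs.v *)
From mathcomp Require Import all_boot.

Set Implicit Arguments.
Unset Strict Implicit.
Unset Printing Implicit Defensive.

Definition e (l k : nat) : nat := \sum_(0 <= j < l) 2 ^ (j * k).

Definition dobbertin (t : nat) : nat :=
  2 ^ (4 * t) + 2 ^ (3 * t) + 2 ^ (2 * t) + 2 ^ t - 1.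

(* The coset consists of reduced residues in [0, 2 ^ n - 1), so membership of
   [x] forces [x < 2 ^ n - 1] (for [1 <= n]); [dobbertin t] satisfies this
   bound for [n = 5 * t] and [1 <= t]. *)
Definition in_cyclotomic_coset (n d x : nat) : Prop :=
  exists a : nat, x = (2 ^ a * d) %% (2 ^ n - 1).

(* Main.v *)
(** Put [N = 2^(5t) - 1], [Q = 2^(4t) + 2^(3t) + 2^(2t) + 2^t + 1], so that
    [(2^t - 1) Q = N] and [D_t = Q - 2].  Multiplying [D_t = 2^a e(l, k)] by
    [2^k - 1] gives [2^k D_t + 2^a = D_t + 2^(a + lk)] modulo [N], hence
    [2^a + 2 = 2^(a + lk) + 2^(k + 1)] modulo [Q].  The four exponents, taken
    modulo [5t], miss one of the five blocks [ut, ..., ut + t - 1]; after a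
    rotation they are all below [4t], both sides are below [Q], and the
    congruence is an equality of integers.  So either [5t] divides [k], or
    [a = k + 1] and [a + lk = 1] modulo [5t].  In the latter case
    [2^k Q = Q] modulo [N], that is, [2^t - 1] divides [2^k - 1].  Either way
    [t] divides [gcd(k, 5t)]. *)
Require Import Defs.
From mathcomp Require Import all_boot zify.

Definition geom5 (t : nat) : nat :=
  2 ^ (4 * t) + 2 ^ (3 * t) + 2 ^ (2 * t) + 2 ^ t + 1.

Lemma geom5_factor (t : nat) : 2 ^ (5 * t) - 1 = (2 ^ t - 1) * geom5 t.
Proof.
rewrite /geom5 !(mulnC _ t) !expnM; set F := 2 ^ t.
by rewrite mulnBl mul1n !mulnDr muln1 -!expnS mulnn; lia.
Qed.

Lemma dobbertinE (t : nat) : dobbertin t + 2 = geom5 t.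
Proof.
have : 0 < 2 ^ t by rewrite expn_gt0.
by rewrite /dobbertin /geom5; lia.
Qed.

(** The geometric sum formula, with the subtractions moved across because they truncate in [nat]. *)
Lemma e_geometric (l k : nat) : 2 ^ k * e l k + 1 = e l k + 2 ^ (l * k).
Proof.
elim: l => [|l IHl]; first by rewrite /e big_geq // muln0 mul0n expn0.
have -> : e l.+1 k = e l k + 2 ^ (l * k) by rewrite /e big_nat_recr.
by rewrite mulSn expnD mulnDr; lia.
Qed.

Lemma expn2_add_inj (x y z w : nat) : 2 ^ x + 2 ^ y = 2 ^ z + 2 ^ w ->
  (x = z /\ y = w) \/ (x = w /\ y = z).
Proof.
wlog le_xy : x y / x <= y.
  move=> H E; have [/H/(_ E)//|/ltnW/H] := leqP x y.
  by rewrite addnC => /(_ E); tauto.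
wlog le_zw : z w / z <= w.
  move=> H E; have [/H/(_ E)//|/ltnW/H] := leqP z w.
  by rewrite [_ ^ w + _]addnC => /(_ E); tauto.
wlog le_xz : x y z w le_xy le_zw / x <= z.
  move=> H E; have [/(H _ _ _ _ le_xy le_zw)/(_ E)//|/ltnW le_zx] := leqP x z.
  by have := H _ _ _ _ le_zw le_xy le_zx (esym E); lia.
have [->|neq_xz] := eqVneq x z.
  by move/addnI/eqP; rewrite eqn_exp2l // => /eqP; left.
have [d [c [-> ->]]] : exists d c, z = x + d.+1 /\ w = x + d.+1 + c.
  by exists (z - x).-1, (w - z); lia.
have [b ->] : exists b, y = x + b by exists (y - x); lia.
(* After division by [2 ^ x] the right side is even and at least 4, while the left side is 2 or
   odd. *)
rewrite !expnD -{1}[2 ^ x]muln1 -mulnA -!mulnDr expnS => /eqP.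
rewrite eqn_pmul2l ?expn_gt0 // -mulnA -mulnDr => /eqP.
have d_gt0 : 0 < 2 ^ d by rewrite expn_gt0.
have c_gt0 : 0 < 2 ^ c by rewrite expn_gt0.
by case: b => [|b]; rewrite ?expn0 ?expnS; nia.
Qed.

(** Pigeonhole: modulo [5 * t], four exponents leave one of the five blocks of length [t] empty. *)
Lemma rotate_below_4t {t : nat} (s : seq nat) : 0 < t -> size s <= 4 ->
  exists c, all (fun x => (x + c) %% (5 * t) < 4 * t) s.
Proof.
move=> t_gt0 s_small; set r := [seq x %/ t %% 5 | x <- s].
have [u u_lt5 u_notin] : exists2 u, u \in iota 0 5 & u \notin r.
  apply/allPn/negP => /allP /(uniq_leq_size (iota_uniq 0 5)).
  by rewrite size_map size_iota; lia.
(* This shift carries the empty block [u] to the top block, numbered 4. *)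
exists ((4 - u) * t); apply/allP => x xs.
have neq : x %/ t %% 5 != u.
  by apply: contraNneq u_notin => <-; apply: map_f.
rewrite mem_iota in u_lt5.
rewrite -ltn_divLR // -modn_divl divnDMl //; lia.
Qed.

Lemma expn2_modn {m n : nat} (x : nat) : m %| 2 ^ n - 1 ->
  2 ^ (x %% n) = 2 ^ x %[mod m].
Proof.
move=> m_dvd; have E : 2 ^ n = 1 %[mod m].
  by apply/eqP; rewrite eqn_mod_dvd // expn_gt0.
rewrite [in RHS](divn_eq x n) expnD mulnC [_ * n]mulnC expnM.
by rewrite -[RHS]modnMmr -[in RHS]modnXm E modnXm exp1n modnMmr muln1.
Qed.

Lemma expn2_add_inj_mod {t x y z w : nat} : 0 < t ->
  2 ^ x + 2 ^ y = 2 ^ z + 2 ^ w %[mod geom5 t] ->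
  (x = z %[mod 5 * t] /\ y = w %[mod 5 * t]) \/
  (x = w %[mod 5 * t] /\ y = z %[mod 5 * t]).
Proof.
move=> t_gt0 E.
have dvdQ : geom5 t %| 2 ^ (5 * t) - 1 by rewrite geom5_factor dvdn_mull.
have [c /and5P[lx ly lz lw _]] :=
  rotate_below_4t [:: x; y; z; w] t_gt0 (leqnn _).
have rot u v : 2 ^ ((u + c) %% (5 * t)) + 2 ^ ((v + c) %% (5 * t)) =
    2 ^ c * (2 ^ u + 2 ^ v) %[mod geom5 t].
  rewrite -modnDm !(expn2_modn _ dvdQ) modnDm !expnD.
  by rewrite -mulnDl mulnC.
(* Each power is at most half of [2 ^ (4 * t)]. *)
have small u v : u < 4 * t -> v < 4 * t -> 2 ^ u + 2 ^ v < geom5 t.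
  have half d : d < 4 * t -> (2 ^ d).*2 <= 2 ^ (4 * t).
    by rewrite -mul2n -expnS leq_exp2l.
  move=> /half ltu /half ltv.
  rewrite /geom5 addn1 ltnS -!addnA; apply: leq_trans (leq_addr _ _).
  by rewrite -leq_double doubleD -[(2 ^ (4 * t)).*2]addnn leq_add.
have := rot x y; rewrite -modnMmr E modnMmr -rot.
rewrite (modn_small (small _ _ lx ly)) (modn_small (small _ _ lz lw)).
move/expn2_add_inj.
by case=> -[/eqP + /eqP]; rewrite !eqn_modDr => /eqP + /eqP; [left|right].
Qed.

(** Reducing [k] modulo [t] leaves a multiple of [2 ^ t - 1] smaller than it, hence zero. *)
Lemma dvdn_expn2_pred (t k : nat) : 0 < t ->
  2 ^ t - 1 %| 2 ^ k - 1 -> t %| k.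
Proof.
move=> t_gt0; rewrite -eqn_mod_dvd ?expn_gt0 // => /eqP.
rewrite -(expn2_modn k (dvdnn _)) => /eqP; rewrite eqn_mod_dvd ?expn_gt0 //.
have lt : 2 ^ (k %% t) < 2 ^ t by rewrite ltn_exp2l ?ltn_pmod.
have gt0 : 0 < 2 ^ (k %% t) by rewrite expn_gt0.
case: (posnP (2 ^ (k %% t) - 1)) => [E _|pos /(dvdn_leq pos)]; last by lia.
rewrite /dvdn -leqn0 -(leq_exp2l _ _ (ltnSn 1)) expn0; lia.
Qed.

Lemma coset_congruence (N a l k x : nat) : x = (2 ^ a * e l k) %% N ->
  2 ^ k * x + 2 ^ a = x + 2 ^ (a + l * k) %[mod N].
Proof.
move=> ->; rewrite -modnDml modnMmr !modnDml expnD mulnCA.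
by rewrite -{2}[2 ^ a]muln1 -!mulnDr e_geometric.
Qed.

Theorem theorem10 (t n l k : nat) (ht : 2 < t) (hn : n = 5 * t)
  (hk : gcdn k n <= 2) :
  ~ in_cyclotomic_coset n (e l k) (dobbertin t).
Proof.
case=> a; subst n => /coset_congruence.
have t_gt0 : 0 < t by lia.
have t_ndvd : ~ t %| k.
  move=> tk; have : t %| gcdn k (5 * t) by rewrite dvdn_gcd tk dvdn_mull.
  by move/dvdn_leq; rewrite gcdn_gt0 muln_gt0 t_gt0 orbT; lia.
set N := 2 ^ (5 * t) - 1; set D := dobbertin t; set b := a + l * k => E.
have DQ : D + 2 = geom5 t := dobbertinE t.
have dvdQ : geom5 t %| N by rewrite /N geom5_factor dvdn_mull.
have Q_gt0 : 0 < geom5 t by rewrite -DQ addn2.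
have EQ : 2 ^ a + 2 ^ 1 = 2 ^ b + 2 ^ k.+1 %[mod geom5 t].
  (* The added term completes each [D] to [D + 2], which vanishes modulo [geom5 t]. *)
  have := congr1 (fun x => (x + (2 ^ k.+1 + 2)) %% geom5 t)
    (congr1 (modn^~ (geom5 t)) E).
  rewrite /= !modn_dvdm // !modnDml.
  have -> : 2 ^ k * D + 2 ^ a + (2 ^ k.+1 + 2) =
      2 ^ k * geom5 t + (2 ^ a + 2 ^ 1) by rewrite -DQ expnS; lia.
  have -> : D + 2 ^ b + (2 ^ k.+1 + 2) = 1 * geom5 t + (2 ^ b + 2 ^ k.+1).
    by rewrite -DQ; lia.
  by rewrite !modnMDl.
case: (expn2_add_inj_mod t_gt0 EQ) => [[_ k0]|[ak b1]].
  apply: t_ndvd; apply: (@dvdn_trans (5 * t)); first exact: dvdn_mull.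
  by move/eqP: k0; rewrite eq_sym eqn_mod_dvd // subn1.
have {}ak : 2 ^ a = 2 ^ k.+1 %[mod N].
  by rewrite -(expn2_modn a (dvdnn N)) ak expn2_modn.
have {}b1 : 2 ^ b = 2 ^ 1 %[mod N].
  by rewrite -(expn2_modn b (dvdnn N)) -b1 expn2_modn.
(* [E] becomes [2 ^ k * (D + 2) = D + 2] modulo [N]; the common factor [geom5 t] then cancels. *)
move: E; rewrite -modnDmr ak modnDmr -[RHS]modnDmr b1 modnDmr.
rewrite expnS expn1 DQ [2 * _]mulnC -mulnDr DQ => /eqP.
rewrite eqn_mod_dvd; last by rewrite leq_pmull ?expn_gt0.
rewrite -[X in _ - X]mul1n -mulnBl /N geom5_factor dvdn_pmul2r //.
by move/(dvdn_expn2_pred _ _ t_gt0).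
Qed.
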